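(* Let $Q\ge 2$ be a fixed integer and let $\rho\in(0,1/2]$ be a fixed real. For a positive integer $\kappa$, let $n=\lfloor\rho\kappa Q\rfloor$. For the load profile chain $\{\xi(t)\}_{t\in\mathbb{Z}_+}$ on $\Xi_{n,S,\kappa}$, the following holds: for each $\varepsilon\in(0,1)$ there exist constants $C_\varepsilon$ and $N_\varepsilon$ such that for all $n\ge N_\varepsilon$, $$\left|T^{\mathrm{mix}}(\varepsilon)-\frac12(1-\rho)\,n\log n\right|\le C_\varepsilon\, n .$$
   Context: Let $Q,\kappa$ be positive integers, $S=\{1,\dots,Q\}$, $N=\kappa Q$, $\rho\in(0,1)$ and $n=\lfloor\rho N\rfloor$ (with $n\ge1$), $\mathbb{Z}_+=\{0,1,2,\dots\}$. Let $$\Xi_{n,S,\kappa}=\Big\{\xi=(\xi_v)_{v\in S}\in\{0,1,\dots,\kappa\}^S:\ \sum_{v\in S}\xi_v=n\Big\}.$$ The load profile chain $\{\xi(t)\}_{t\in\mathbb{Z}_+}$ is the discrete-time Markov chain on $\Xi_{n,S,\kappa}$ with the following transitions: for each pair $v_-\neq v_+$ in $S$, it moves from $\xi$ to the state obtained by decreasing $\xi_{v_-}$ by $1$ and increasing $\xi_{v_+}$ by $1$ with probability $\frac{\xi_{v_-}}{n}\cdot\frac{\kappa-\xi_{v_+}}{1+N-n}$, and it stays at $\xi$ with the remaining probability $\sum_{v\in S}\frac{\xi_v}{n}\cdot\frac{1+\kappa-\xi_v}{1+N-n}$. It is irreducible and aperiodic, and reversible with respect to its unique stationary distribution $\pi_n(\xi)\propto\prod_{v\in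 S}\frac{1}{\xi_v!(\kappa-\xi_v)!}$. (It is the process of occupation counts $\xi_v(t)=\#\{i:\sigma_i(t)=v\}$ of the Glauber dynamics $\sigma(t)$ in which a uniformly chosen one of $n$ players releases its resource and picks a new resource $v$ with probability proportional to the number of unused copies of $v$, each of the $Q$ resources having $\kappa$ copies.) $\mathbf{P}_{\xi_0}$ denotes the law of the chain started from $\xi_0$. $D_{\mathrm{TV}}(t)=\max_{\xi_0\in\Xi_{n,S,\kappa}}\max_{A\subset\Xi_{n,S,\kappa}}|\mathbf{P}_{\xi_0}(\xi(t)\in A)-\pi_n(A)|$ and $T^{\mathrm{mix}}(\varepsilon)=\min\{t\ge0:D_{\mathrm{TV}}(t)\le\varepsilon\}$. Constants may depend on the fixed parameters $Q$ and $\rho$. *)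

(* Defs.v *)
From HB Require Import structures.
From mathcomp Require Import all_boot all_order all_algebra.
From mathcomp Require Import all_classical all_reals all_analysis.

Set Implicit Arguments.
Unset Strict Implicit.
Unset Printing Implicit Defensive.

Import Order.TTheory GRing.Theory Num.Theory.

Local Open Scope ring_scope.

Section FiniteChain.
Variables (R : realType) (T : finType).
Implicit Types (P : T -> T -> R) (mu pi : T -> R).

Definition mass mu (A : {set T}) : R := \sum_(x in A) mu x.

(* [P x y] is the probability of jumping from x to y; distributions are
   pushed forward by acting on the left of P. *)
Definition step P mu : T -> R := fun y => \sum_(x : T) mu x * P x y.

Definition law P (x0 : T) (t : nat) : T -> R :=
  iter t (step P) (fun x => (x == x0)%:R).

(* The default value 0 of the maxima is harmless: all terms are >= 0. *)
Definition tv_dist P pi (t : nat) : R :=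
  \big[Num.max/0]_(x0 : T) \big[Num.max/0]_(A : {set T})
    `|mass (law P x0 t) A - mass pi A|.

(* tmix = min {t >= 0 : tv_dist P pi t <= eps}; a relation rather than a
   function, so that no junk value is needed when the set is empty. *)
Definition is_mixing_time P pi (eps : R) (tmix : nat) : Prop :=
  tv_dist P pi tmix <= eps /\
  (forall t : nat, tv_dist P pi t <= eps -> (tmix <= t)%N).

End FiniteChain.

Section LoadProfile.
Variables (R : realType) (Q kappa n : nat).

Definition profile : finType :=
  {xi : {ffun 'I_Q -> 'I_kappa.+1} | (\sum_(v < Q) xi v == n)%N}.

Definition load (xi : profile) (v : 'I_Q) : nat := sval xi v.

(* eta = xi - e_vm + e_vp, written without truncated subtraction *)
Definition moved (xi : profile) (vm vp : 'I_Q) (eta : profile) : bool :=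
  [forall v, load eta v + (v == vm) == load xi v + (v == vp)]%N.

(* the factor 1 + N - n, where N = kappa * Q is the number of copies *)
Definition free_copies : R := 1 + (kappa * Q)%:R - n%:R.

Definition move_prob (xi : profile) (vm vp : 'I_Q) : R :=
  (load xi vm)%:R / n%:R * ((kappa%:R - (load xi vp)%:R) / free_copies).

Definition stay_prob (xi : profile) : R :=
  \sum_(v < Q) (load xi v)%:R / n%:R *
               ((1 + kappa%:R - (load xi v)%:R) / free_copies).

(* A move that would leave the state space has no target eta, but it also
   has [move_prob] equal to 0. *)
Definition profile_trans (xi eta : profile) : R :=
  (\sum_(vm < Q) \sum_(vp < Q | (vm != vp) && moved xi vm vp eta)
      move_prob xi vm vp)
  + (if eta == xi then stay_prob xi else 0).

Definition profile_weight (xi : profile) : R :=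
  \prod_(v < Q) ((load xi v)`! * (kappa - load xi v)`!)%:R^-1.

Definition profile_pi (xi : profile) : R :=
  profile_weight xi / \sum_(eta : profile) profile_weight eta.

End LoadProfile.

(* Main.v *)
(* Number the N = kappa Q copies and let the n occupied ones perform the walk
   "remove a uniform copy, then add a uniform free copy". Its occupation counts
   are the load profile chain, and the uniform law on n-subsets projects to pi_n.

   Upper bound. The walk is symmetric and transitive, so the squared L2 distance
   to uniformity at time t is tr(P^{2t}) - 1 from every starting point. Up to the
   factor n D, with D = 1 + N - n, P is the Gram matrix B B^T of the inclusion of
   (n-1)-subsets in n-subsets, while B^T B is the same Gram matrix one level below
   plus a scalar; as B B^T and B^T B have the same nonzero spectrum, induction on
   the level gives tr(P^{2t}) = sum_i (C(N,i) - C(N,i-1)) ((1-i/n)(1-i/D))^{2t}.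
   This is bounded by a geometric series of ratio N exp(-2t (1/n + 1/D)), which is
   small as soon as t exceeds (1-rho) n log n / 2 + O(n).

   Lower bound. The excess load xi_v - n/Q of one resource is an eigenfunction with
   eigenvalue 1 - N/(nD) whose variance stays below nD/N <= n; from an extreme
   profile its mean exceeds the order sqrt n until time
   (1-rho) n log n / 2 - O(n), and Chebyshev's inequality separates the laws. *)

Require Import Defs.
From HB Require Import structures.
From mathcomp Require Import all_boot all_order all_algebra.
From mathcomp Require Import all_classical all_reals all_analysis.
From mathcomp Require Import zify ring lra.
From mathcomp Require Import perm finset.

Import Order.TTheory GRing.Theory Num.Theory.

Local Open Scope ring_scope.

Set Implicit Arguments.
Unset Strict Implicit.
Unset Printing Implicit Defensive.

(** * Finite Markov chains *)

Section FiniteChains.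
Variable R : realType.

Lemma lawS (T : finType) (P : T -> T -> R) x t y :
  law P x t.+1 y = \sum_z law P x t z * P z y.
Proof. by []. Qed.

Lemma law_sum (T : finType) (P : T -> T -> R) (g : T -> R) x t :
  \sum_y law P x t.+1 y * g y
  = \sum_z law P x t z * \sum_y P z y * g y.
Proof.
under eq_bigr => y _ do rewrite lawS mulr_suml.
rewrite exchange_big /=; apply: eq_bigr => z _.
by rewrite mulr_sumr; apply: eq_bigr => y _; rewrite mulrA.
Qed.

Lemma law_mass1 (T : finType) (P : T -> T -> R) x t :
  (forall z, \sum_y P z y = 1) -> \sum_y law P x t y = 1.
Proof.
move=> P1; elim: t => [|t IHt].
  by rewrite (bigD1 x) //= /law /= eqxx big1 ?addr0 // => y /negbTE ->.
rewrite -[RHS]IHt; have := law_sum P (fun=> 1) x t.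
under eq_bigr do rewrite mulr1.
move=> ->; apply: eq_bigr => z _.
by under eq_bigr do rewrite mulr1; rewrite P1 mulr1.
Qed.

Lemma law_ge0 (T : finType) (P : T -> T -> R) x t y :
  (forall z w, 0 <= P z w) -> 0 <= law P x t y.
Proof.
move=> P0; elim: t y => [|t IHt] y; first by rewrite /law /= ler0n.
by rewrite lawS sumr_ge0 // => z _; rewrite mulr_ge0.
Qed.

Lemma lawD (T : finType) (P : T -> T -> R) x s t y :
  law P x (s + t) y = \sum_z law P x s z * law P z t y.
Proof.
elim: t y => [|t IHt] y.
  rewrite addn0 (bigD1 y) //= /law /= eqxx mulr1 big1 ?addr0 // => z zy.
  by rewrite eq_sym (negbTE zy) mulr0.
rewrite addnS lawS; under eq_bigr => z _ do rewrite IHt mulr_suml.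
rewrite exchange_big; apply: eq_bigr => z _.
by rewrite [in RHS]lawS mulr_sumr; apply: eq_bigr => w _; rewrite mulrA.
Qed.

Lemma law_first (T : finType) (P : T -> T -> R) x t y :
  law P x t.+1 y = \sum_z P x z * law P z t y.
Proof.
rewrite -addn1 addnC lawD; apply: eq_bigr => z _; congr (_ * _).
rewrite (lawS P x 0) (bigD1 x) //= big1 ?addr0; first by rewrite /law /= eqxx mul1r.
by move=> w wx; rewrite /law /= (negbTE wx) mul0r.
Qed.

Lemma law_sym (T : finType) (P : T -> T -> R) x t y :
  (forall z w, P z w = P w z) -> law P x t y = law P y t x.
Proof.
move=> Psym; elim: t x y => [|t IHt] x y; first by rewrite /law /= eq_sym.
rewrite lawS law_first; apply: eq_bigr => z _.
by rewrite IHt Psym mulrC.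
Qed.

Lemma law_equivariant (T : finType) (P : T -> T -> R) (s : T -> T) x t y :
  bijective s -> (forall z w, P (s z) (s w) = P z w) ->
  law P (s x) t (s y) = law P x t y.
Proof.
move=> bs Ps; have js := bij_inj bs.
elim: t y => [|t IHt] y; first by rewrite /law /= (inj_eq js).
rewrite !lawS (reindex s) /=; last exact: onW_bij.
by apply: eq_bigr => z _; rewrite IHt Ps.
Qed.

(** Dynkin's lumpability criterion; it carries the laws of the walk on subsets over to the load
    profile chain. *)
Lemma law_lumped (X Y : finType) (P : X -> X -> R) (K : Y -> Y -> R)
    (f : X -> Y) x t y :
  (forall x y, \sum_(z | f z == y) P x z = K (f x) y) ->
  law K (f x) t y = \sum_(z | f z == y) law P x t z.
Proof.
move=> lump; elim: t y => [|t IHt] y.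
  rewrite /law /= big_mkcond /= (bigD1 x) //= eqxx big1 ?addr0.
    by rewrite eq_sym; case: eqP.
  by move=> z /negbTE ->; case: ifP.
rewrite lawS; under eq_bigr => w _ do rewrite IHt mulr_suml.
under [RHS]eq_bigr => z _ do rewrite lawS.
rewrite [RHS]exchange_big /= [RHS](partition_big f xpredT) //=.
apply: eq_bigr => w _; apply: eq_bigr => z /eqP fz.
by rewrite -mulr_sumr lump fz.
Qed.

Lemma mass_lumped (X Y : finType) (f : X -> Y) (mu : X -> R) (nu : Y -> R)
    (A : {set Y}) :
  (forall y, nu y = \sum_(z | f z == y) mu z) ->
  mass nu A = \sum_(z | f z \in A) mu z.
Proof.
move=> numu; rewrite /mass (partition_big f (mem A)) //=.
apply: eq_bigr => y yA; rewrite numu; apply: eq_bigl => z.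
by case: eqP => [->|_]; rewrite ?yA ?andbF.
Qed.

(** * Total variation distance and its L2 bound *)

Lemma le_tv_dist (T : finType) (P : T -> T -> R) pi t x A :
  `|mass (law P x t) A - mass pi A| <= tv_dist P pi t.
Proof.
apply: le_trans (le_bigmax _ _ x).
exact: (le_bigmax _ (fun A => `|mass (law P x t) A - mass pi A|) A).
Qed.

Lemma tv_dist_le (T : finType) (P : T -> T -> R) pi t e : 0 <= e ->
  (forall x A, `|mass (law P x t) A - mass pi A| <= e) -> tv_dist P pi t <= e.
Proof.
by move=> e0 H; apply: bigmax_le => // x _; apply: bigmax_le => // A _.
Qed.

(** Cauchy-Schwarz against the indicator of [p], whose size is bounded by [#|T|]: expand the
    nonnegative sum of the squares of [u x - (p x)%:R * (c / N)]. *)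
Lemma sqr_sum_le (T : finType) (p : pred T) (u : T -> R) :
  (\sum_(x | p x) u x) ^+ 2 <= #|T|%:R * \sum_x u x ^+ 2.
Proof.
have [T0|T0] := posnP #|T|.
  rewrite T0 mul0r big1 ?expr0n // => x _.
  by have := card0_eq T0 x; rewrite inE.
have N0 : 0 < #|T|%:R :> R by rewrite ltr0n.
set c := \sum_(x | p x) u x; set s := \sum_x _; set N : R := #|T|%:R in N0 *.
have H : 0 <= \sum_x (u x - (p x)%:R * (c / N)) ^+ 2.
  by rewrite sumr_ge0 // => x _; rewrite sqr_ge0.
have E : \sum_x (u x - (p x)%:R * (c / N)) ^+ 2
    = s - (c / N) *+ 2 * c + #|p|%:R * (c / N) ^+ 2.
  have cE : c = \sum_x (p x)%:R * u x.
    rewrite /c big_mkcond; apply: eq_bigr => x _.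
    by case: (p x); rewrite ?mul1r ?mul0r.
  have -> : #|p|%:R = \sum_x (p x)%:R :> R.
    rewrite -sum1_card natr_sum big_mkcond; apply: eq_bigr => x _.
    by rewrite unfold_in; case: (p x).
  move: (c / N) => d; rewrite cE mulr_sumr mulr_suml -sumrB -big_split /=.
  apply: eq_bigr => x _; case: (p x); rewrite ?mul1r ?mul0r ?mulr0 ?subr0 ?addr0 //.
  by rewrite -mulr_natl; ring.
have pN : #|p|%:R <= N by rewrite ler_nat max_card.
have : #|p|%:R * (c / N) ^+ 2 <= c ^+ 2 / N.
  rewrite (_ : c ^+ 2 / N = N * (c / N) ^+ 2); last by field; rewrite gt_eqF.
  by rewrite ler_wpM2r // sqr_ge0.
move: H; rewrite E (_ : (c / N) *+ 2 * c = 2 * (c ^+ 2 / N)); last by rewrite -mulr_natl; ring.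
move=> H1 H2; rewrite -ler_pdivrMl // mulrC; lra.
Qed.

(* For symmetric [P] the squared L2 distance of [law P x t] to the uniform
   distribution is governed by the return probability at time [2t]. *)
Lemma sqr_mass_sub_uniform_le (T : finType) (P : T -> T -> R) x t (p : pred T) :
  (forall z w, P z w = P w z) -> (forall z, \sum_w P z w = 1) ->
  (\sum_(y | p y) law P x t y - #|p|%:R / #|T|%:R) ^+ 2
  <= #|T|%:R * law P x (t + t) x - 1.
Proof.
move=> Psym P1; have T0 : 0 < #|T|%:R :> R by rewrite ltr0n; apply/card_gt0P; exists x.
have -> : \sum_(y | p y) law P x t y - #|p|%:R / #|T|%:R
    = \sum_(y | p y) (law P x t y - #|T|%:R^-1).
  rewrite sumrB; congr (_ - _).
  by rewrite sumr_const mulr_natl.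
(* By symmetry and Chapman-Kolmogorov, the sum of [law P x t y ^+ 2] over [y] is the return
   probability at time [t + t]. *)
apply: le_trans (sqr_sum_le _ _) _; rewrite lawD.
under eq_bigr => y _ do rewrite sqrrB.
rewrite !big_split sumrN sumrMnl -mulr_suml law_mass1 // sumr_const /=.
under [X in _ <= _ * X - _]eq_bigr => y _ do rewrite (law_sym y t x Psym) -expr2.
rewrite -[_ *+ 2]mulr_natl -[_ *+ #|_|]mulr_natl.
by rewrite le_eqVlt; apply/orP; left; apply/eqP; field; rewrite gt_eqF.
Qed.

End FiniteChains.

(** * Traces in the Johnson scheme *)

Section JohnsonTrace.

(* The spectra of [B *m C] and [C *m B] differ only in the multiplicity of 0. *)
Lemma mxtrace_exp_mulmxC (R : comNzRingType) p q (B : 'M[R]_(p, q))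
    (C : 'M[R]_(q, p)) (a : R) m :
  \tr ((B *m C + a%:M) ^+ m) - \tr ((C *m B + a%:M) ^+ m)
  = a ^+ m * (p%:R - q%:R).
Proof.
elim: m => [|m IHm]; first by rewrite !expr0 mul1r !mxtrace1.
set M := B *m C + _ in IHm *; set L := C *m B + _ in IHm *.
(* [C] intertwines the powers of [M] and [L]; with the cyclicity of the trace, the [B *m C] and
   [C *m B] terms cancel and only [a] times the previous difference survives. *)
have comm k : C *m M ^+ k = L ^+ k *m C.
  elim: k => [|k IHk]; first by rewrite !expr0 mulmx1 mul1mx.
  rewrite !exprS -!mulmxE -[in RHS]mulmxA -IHk !mulmxA; congr (_ *m _).
  by rewrite mulmxDr mulmxDl mulmxA scalar_mxC.
have swap : \tr (B *m C *m M ^+ m) = \tr (C *m B *m L ^+ m).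
  by rewrite -mulmxA mxtrace_mulC comm -(mulmxA (L ^+ m)) mxtrace_mulC.
rewrite !exprS -!mulmxE {1}/M {1}/L !mulmxDl !mxtraceD swap !mul_scalar_mx.
by rewrite !mxtraceZ opprD addrACA subrr add0r -mulrBr IHm mulrA.
Qed.

Variables (R : realType) (T : finType).

Definition ksubset k : finType := {A : {set T} | #|A| == k}.


Lemma card_ksubset k : #|ksubset k| = 'C(#|T|, k).
Proof. by rewrite card_sig -(card_draws T k) cardsE; apply: eq_card. Qed.

Lemma sum_ksubset k (F : {set T} -> R) :
  \sum_(A : ksubset k) F (val A) = \sum_(A : {set T} | #|A| == k) F A.
Proof. exact: esym (big_sub [pred A : {set T} | #|A| == k] F). Qed.

Lemma sum_enum_val (X : finType) (F : X -> R) :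
  \sum_(a < #|X|) F (enum_val a) = \sum_x F x.
Proof. by rewrite (big_enum_val F). Qed.

(* The Gram matrix of the inclusion of [(k - 1)]-subsets into [k]-subsets, written
   with a successor so that it vanishes for [k = 0]. *)
Definition shadow k (A B : {set T}) : R :=
  #|[set U : {set T} | (U \subset A :&: B) & (#|U|.+1 == k)%N]|%:R.

Definition shadow_mx k : 'M[R]_#|ksubset k| :=
  \matrix_(a < #|ksubset k|, b < #|ksubset k|) shadow k (val (enum_val a)) (val (enum_val b)).

Definition incl_mx k : 'M[R]_(#|ksubset k.+1|, #|ksubset k|) :=
  \matrix_(a < #|ksubset k.+1|, b < #|ksubset k|) (val (enum_val b) \subset val (enum_val a))%:R.

Lemma incl_mx_gram k : incl_mx k *m (incl_mx k)^T = shadow_mx k.+1.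
Proof.
apply/matrixP => a b; rewrite !mxE.
under eq_bigr => c _ do rewrite !mxE -natrM mulnb -subsetI.
set A := _ :&: _.
rewrite (sum_enum_val (fun U : ksubset k => (val U \subset A)%:R)).
rewrite (sum_ksubset k (fun U => (U \subset A)%:R)) /shadow -sum1_card natr_sum.
rewrite big_mkcond [RHS]big_mkcond; apply: eq_bigr => U _.
by rewrite inE eqSS andbC; case: eqP; case: (_ \subset _).
Qed.

Lemma shadowE k A B : shadow k A B = if k is k'.+1 then 'C(#|A :&: B|, k')%:R else 0.
Proof.
case: k => [|k]; last by rewrite -cards_draws.
by rewrite /shadow (_ : [set _ | _ & _] = set0) ?cards0 //; apply/setP => U; rewrite !inE andbF.
Qed.

(** Complementation turns supersets of [W] into subsets of its complement. *)
Lemma card_supersets (W : {set T}) k : (k <= #|T|)%N ->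
  #|[set A : {set T} | (W \subset A) & (#|A| == k)%N]| = 'C(#|T| - #|W|, #|T| - k).
Proof.
move=> kT; have <- : #|~: W| = (#|T| - #|W|)%N by rewrite [LHS]cardsCs setCK.
rewrite -cards_draws.
rewrite -(card_imset _ (@finset.setC_inj T)); apply: eq_card => A.
apply/imsetP/idP => [[B]|].
  rewrite !inE => /andP[WB /eqP Bk] ->; rewrite setCS WB /=.
  by rewrite cardsCs setCK Bk.
rewrite !inE => /andP[AW /eqP Ak]; exists (~: A); last by rewrite setCK.
by rewrite !inE -setCS setCK AW /= cardsCs setCK Ak subKn.
Qed.

(** Two distinct [k]-sets have one common superset of size [k.+1] exactly when they have one common
    subset of size [k - 1], and otherwise neither, so off the diagonal both counts agree. On the
    diagonal they are [#|T| - k] and [k]. *)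
Lemma incl_mx_cogram k : (k < #|T|)%N ->
  (incl_mx k)^T *m incl_mx k = shadow_mx k + (#|T|%:R - k%:R *+ 2)%:M.
Proof.
move=> kT; apply/matrixP => a b; rewrite !mxE.
under eq_bigr => c _ do rewrite !mxE -natrM mulnb -subUset.
have [ka kb] : #|val (enum_val a)| = k /\ #|val (enum_val b)| = k.
  by split; apply/eqP; [exact: (valP (enum_val a)) | exact: (valP (enum_val b))].
have -> : (a == b) = (val (enum_val a) == val (enum_val b)).
  by rewrite (inj_eq val_inj) (inj_eq enum_val_inj).
move: (val _) (val (enum_val b)) ka kb => {a b} A B kA kB.
rewrite (sum_enum_val (fun U : ksubset k.+1 => (A :|: B \subset val U)%:R)).
rewrite (sum_ksubset k.+1 (fun U => (A :|: B \subset U)%:R)).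
transitivity (#|[set U : {set T} | (A :|: B \subset U) & (#|U| == k.+1)%N]|%:R : R).
  rewrite -sum1_card natr_sum big_mkcond [RHS]big_mkcond.
  by apply: eq_bigr => U _; rewrite inE andbC; case: eqP; case: (_ \subset _).
rewrite card_supersets // shadowE cardsU kA kB.
have [<-|AB] := eqVneq A B.
  rewrite setIid kA addnK mulr1n subnS.
  have -> : 'C(#|T| - k, (#|T| - k).-1) = (#|T| - k)%N.
    by rewrite -subn1 bin_sub ?bin1 // subn_gt0.
  case: {kA kB} k kT => [|k] kT; first by rewrite subn0 add0r mul0rn subr0.
  rewrite binSn natrB 1?ltnW // -mulr_natl; ring.
rewrite mulr0n addr0.
have ltk : (#|A :&: B| < k)%N.
  rewrite ltn_neqAle -{2}kA subset_leq_card ?subsetIl // andbT.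
  apply: contra AB => /eqP ABk; rewrite eqEcard kA kB leqnn andbT.
  by apply/setIidPl/eqP; rewrite eqEcard subsetIl ABk kA leqnn.
have UT : (k + k - #|A :&: B| <= #|T|)%N.
  by have := max_card (A :|: B); rewrite cardsU kA kB.
case: k kT ltk UT {kA kB} => // k kT /[swap] UT; rewrite ltnS leq_eqVlt => /orP[/eqP ->|ltk].
  rewrite binn (_ : (k.+1 + k.+1 - k = k.+2)%N) ?binn //; lia.
by rewrite !bin_small //; lia.
Qed.

(* The dimension of the [i]-th eigenspace of the Johnson scheme; negative for
   [i] beyond [#|T|./2], where the trace formula below still holds. *)
Definition johnson_dim i : R :=
  'C(#|T|, i)%:R - (if i is i'.+1 then 'C(#|T|, i')%:R else 0).

(** Each descent by one level replaces [B B^T] by [B^T B], which brings in a scalar; hence the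
    arbitrary shift [a]. The change of dimension yields the new term [i = k.+1], where the product
    vanishes and only [a ^+ m] remains. *)
Lemma mxtrace_shadow k m (a : R) : (k <= #|T|)%N ->
  \tr ((shadow_mx k + a%:M) ^+ m)
  = \sum_(i < k.+1) johnson_dim i *
      ((k%:R - i%:R) * (#|T|%:R + 1 - k%:R - i%:R) + a) ^+ m.
Proof.
elim: k a => [|k IHk] a kT.
  rewrite big_ord1 subrr mul0r add0r /johnson_dim bin0 subr0 mul1r.
  have -> : shadow_mx 0 = 0 by apply/matrixP => u v; rewrite !mxE shadowE.
  rewrite add0r.
  have -> : (a%:M : 'M[R]_#|ksubset 0|) ^+ m = (a ^+ m)%:M.
    elim: m => [|m IHm]; first by rewrite !expr0.
    by rewrite !exprS -mulmxE IHm -scalar_mxM.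
  by rewrite mxtrace_scalar card_ksubset bin0.
rewrite -incl_mx_gram.
have /eqP := mxtrace_exp_mulmxC (incl_mx k) (incl_mx k)^T a m.
rewrite subr_eq => /eqP ->; rewrite incl_mx_cogram // -addrA -raddfD IHk 1?ltnW //=.
rewrite [RHS]big_ord_recr /= addrC !card_ksubset subrr mul0r add0r mulrC.
(* The scalar [#|T| - 2 k] completes [(k - i) (#|T| + 1 - k - i)] to
   [(k + 1 - i) (#|T| - k - i)]. *)
congr (_ + _); apply: eq_bigr => i _; congr (_ * _ ^+ m).
by rewrite -mulr_natl -[k.+1%:R]natr1; ring.
Qed.

End JohnsonTrace.

(** * The down-up walk on subsets *)

Section DownUpWalk.
Variables (R : realType) (T : finType) (n : nat).
Hypotheses (n_gt0 : (0 < n)%N) (leqnT : (n <= #|T|)%N).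

Let free : R := 1 + #|T|%:R - n%:R.

(* Remove a uniform element, then add a uniform element of the complement (the
   removed one is allowed). *)
Definition down_up (A B : ksubset T n) : R :=
  shadow R n (val A) (val B) / (n%:R * (1 + #|T|%:R - n%:R)).

Let free_gt0 : 0 < free.
Proof. by rewrite /free -addrA ltr_wpDr ?subr_ge0 ?ler_nat. Qed.

Let nfree_gt0 : 0 < n%:R * free.
Proof. by rewrite mulr_gt0 ?ltr0n. Qed.

Lemma down_up_sym A B : down_up A B = down_up B A.
Proof. by rewrite /down_up /shadow setIC. Qed.

Lemma down_up_ge0 A B : 0 <= down_up A B.
Proof. by rewrite divr_ge0 ?ler0n // ltW. Qed.

Lemma sum_facets (A : {set T}) (F : {set T} -> R) :
  \sum_(U : {set T} | (U \subset A) && (#|U|.+1 == #|A|)%N) F U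
  = \sum_(b in A) F (A :\ b).
Proof.
have inj : {in A &, injective (fun b => A :\ b)}.
  move=> b c bA cA /setP/(_ b); rewrite !inE eqxx bA andbT /=.
  by case: eqP.
rewrite -(big_imset F inj) /=; apply: eq_bigl => U; apply/idP/imsetP.
  move=> /andP[UA /eqP cU]; have : #|A :\: U| == 1%N.
    by rewrite cardsD (setIidPr UA) -cU subSnn.
  move=> /cards1P[b bE]; have bA : b \in A by move/setP/(_ b): bE; rewrite !inE eqxx => /andP[].
  exists b => //; apply/eqP; rewrite eqEcard subsetD1 UA /=.
  have bU : b \notin U by move/setP/(_ b): bE; rewrite !inE eqxx => /andP[].
  by rewrite bU /=; move: cU; rewrite (cardsD1 b A) bA => -[->].
move=> [b bA ->]; rewrite subsetDl /=.
by rewrite (cardsD1 b A) bA.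
Qed.

Lemma sum_cofacets (U : {set T}) (F : {set T} -> R) :
  \sum_(B : {set T} | (U \subset B) && (#|U|.+1 == #|B|)%N) F B
  = \sum_(c | c \notin U) F (c |: U).
Proof.
have inj : {in ~: U &, injective (fun c => c |: U)}.
  move=> b c; rewrite !inE => bU cU /setP/(_ b).
  by rewrite !inE eqxx (negbTE bU) !orbF; case: eqP.
under [RHS]eq_bigl => c do rewrite -in_setC.
rewrite -(big_imset F inj) /=; apply: eq_bigl => B; apply/idP/imsetP.
  move=> /andP[UB /eqP cB]; have : #|B :\: U| == 1%N.
    by rewrite cardsD (setIidPr UB) -cB subSnn.
  move=> /cards1P[c cE]; have : c \in B :\: U by rewrite cE inE eqxx.
  rewrite inE => /andP[cU Bc]; exists c; first by rewrite inE.
  by rewrite -cE setUC -{1}(setIidPr UB) setID.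
by move=> [c]; rewrite inE => cU ->; rewrite subsetUr cardsU1 cU add1n eqxx.
Qed.

(** Recovers the two-stage walk from the Gram matrix: a common facet [U] of [A] and [B] amounts to a
    removed point [b] followed by an added point [c]. *)
Lemma sum_down_up (A : ksubset T n) (g : {set T} -> R) :
  \sum_B down_up A B * g (val B)
  = (\sum_(b in val A) \sum_(c | c \notin val A :\ b) g (c |: (val A :\ b)))
    / (n%:R * free).
Proof.
have cA : #|val A| = n by apply/eqP/(valP A).
rewrite (sum_ksubset n (fun B =>
  shadow R n (val A) B / (n%:R * (1 + #|T|%:R - n%:R)) * g B)).
under eq_bigr => B _ do rewrite mulrAC.
rewrite -mulr_suml; congr (_ / _).
rewrite -(sum_facets _ (fun U => \sum_(c | c \notin U) g (c |: U))).
under [RHS]eq_bigr => U _ do rewrite -sum_cofacets.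
rewrite (exchange_big_dep (fun B : {set T} => #|B| == n)) /=; last first.
  by move=> U B /andP[_ /eqP UA] /andP[_ /eqP <-]; rewrite UA cA.
apply: eq_bigr => B /eqP cB; rewrite /shadow -sum1_card natr_sum mulr_suml.
apply: eq_big => [U|U _]; last by rewrite mul1r.
rewrite inE subsetI cA cB.
by case: (U \subset val A) => //=; case: eqP => _; rewrite ?andbF ?andbT.
Qed.

Lemma sum_down_up1 A : \sum_B down_up A B = 1.
Proof.
have cA : #|val A| = n by apply/eqP/(valP A).
have := sum_down_up A (fun=> 1); under eq_bigr do rewrite mulr1.
move=> ->; rewrite -[RHS](divff (lt0r_neq0 nfree_gt0)); congr (_ / _).
rewrite mulr_natl -[in RHS]cA -sumr_const; apply: eq_bigr => b bA.
rewrite sumr_const.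
have -> : #|[pred c | c \notin val A :\ b]| = (#|T| - n).+1.
  rewrite (eq_card (B := ~: (val A :\ b))); last by move=> c; rewrite !inE.
  by rewrite cardsCs setCK; move: cA leqnT; rewrite (cardsD1 b) bA; lia.
by rewrite -natr1 natrB // /free; ring.
Qed.

(** The left side is the trace of the [m]-th power of the transition matrix, a multiple of
    [shadow_mx]. *)
Lemma sum_law_diag m :
  \sum_A law down_up A m A
  = \sum_(i < n.+1) johnson_dim R T i *
      ((n%:R - i%:R) * (free - i%:R) / (n%:R * free)) ^+ m.
Proof.
pose c := (n%:R * free)^-1.
pose M := c *: shadow_mx R T n.
have lawE a b : law down_up (enum_val a) m (enum_val b) = (M ^+ m) a b.
  elim: m b => [|k IHk] b.
    by rewrite expr0 /law /= mxE (inj_eq enum_val_inj) eq_sym.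
  rewrite exprSr -mulmxE mxE lawS -sum_enum_val; apply: eq_bigr => d _.
  by rewrite IHk /M !mxE /down_up [c * _]mulrC.
rewrite -sum_enum_val; under eq_bigr do rewrite lawE.
have MX k : M ^+ k = c ^+ k *: shadow_mx R T n ^+ k.
  elim: k => [|k IHk]; first by rewrite !expr0 scale1r.
  by rewrite !exprS -!mulmxE IHk -scalemxAl -scalemxAr scalerA.
rewrite -/(\tr (M ^+ m)) MX mxtraceZ.
have := mxtrace_shadow m (0 : R) leqnT; rewrite raddf0 addr0 => ->.
rewrite mulr_sumr; apply: eq_bigr => i _; rewrite mulrCA; congr (_ * _).
by rewrite -exprMn /c addr0 mulrC; congr ((_ * _ / _) ^+ _); rewrite /free; ring.
Qed.

(** Transpositions of the ground set are symmetries of the walk. Swapping a point of [A] outside [B]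
    with a point of [B] outside [A] brings [A] closer to [B], so induction on the size of the
    difference applies. *)
Lemma law_diag_const m (A B : ksubset T n) :
  law down_up A m A = law down_up B m B.
Proof.
have [d] := ubnP #|val A :\: val B|; elim: d A => // d IHd A ltd.
have cA : #|val A| = n by apply/eqP/(valP A).
have cB : #|val B| = n by apply/eqP/(valP B).
have [AB|] := boolP (val A \subset val B).
  suff -> : A = B by [].
  by apply/val_inj/eqP; rewrite eqEcard AB cA cB /=.
move=> AB; have BA : ~~ (val B \subset val A).
  apply: contra AB => BA; have/eqP<- : val B == val A by rewrite eqEcard BA cA cB /=.
  by [].
case/subsetPn: AB => a aA aB; case/subsetPn: BA => b bB bA.
pose s := tperm a b.
have cs (C : ksubset T n) : #|s @: val C| == n.
  by rewrite card_imset ?(eqP (valP C)) //; exact: perm_inj.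
pose S (C : ksubset T n) : ksubset T n := Sub (s @: val C) (cs C).
have SK : involutive S.
  move=> C; apply: val_inj; rewrite /= -imset_comp -[RHS]imset_id.
  by apply: eq_imset => x /=; rewrite /s tpermK.
have up (C : ksubset T n) : val (S C) = s @: val C by [].
have ss (U : {set T}) : s @: (s @: U) = U.
  by rewrite -imset_comp -[RHS]imset_id; apply: eq_imset => x /=; rewrite /s tpermK.
have PS C E : down_up (S C) (S E) = down_up C E.
  congr (_ / _); rewrite /shadow !up -imsetI; last by move=> x y _ _; apply: perm_inj.
  congr (_%:R); rewrite -(card_imset _ (imset_inj (@perm_inj _ s))).
  apply: eq_card => U; rewrite inE; apply/imsetP/andP.
    move=> [W]; rewrite inE => /andP[WS cW] ->; rewrite card_imset; last exact: perm_inj.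
    by rewrite -[_ :&: _]ss imsetS.
  move=> [US cU]; exists (s @: U); last by rewrite ss.
  by rewrite inE card_imset ?cU ?andbT ?imsetS //; exact: perm_inj.
rewrite -(law_equivariant A m A (inv_bij SK) PS); apply: IHd.
rewrite up -ltnS; apply: leq_trans ltd; rewrite ltnS; apply: proper_card; apply/properP; split.
  apply/fintype.subsetP => x; rewrite !inE => /andP[xB /imsetP[y yA xE]].
  rewrite xB /= xE /s; case: tpermP => [ya|yb|_ _] //.
  by move: xB; rewrite xE /s ya tpermL bB.
exists a; first by rewrite inE aA aB.
rewrite inE aB /=; apply/imsetP => -[y yA aE].
have yb : y = b by rewrite -[LHS](tpermK a b) -/s -aE /s tpermL.
by move: bA; rewrite -yb yA.
Qed.

(** As return probabilities are constant, the L2 bound is the trace minus 1, and this 1 cancels the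
    term [i = 0]. *)
Lemma sqr_mass_down_up_le t A (p : pred (ksubset T n)) :
  (\sum_(B | p B) law down_up A t B - #|p|%:R / #|ksubset T n|%:R) ^+ 2
  <= \sum_(i < n) johnson_dim R T i.+1 *
       ((n%:R - i.+1%:R) * (free - i.+1%:R) / (n%:R * free)) ^+ (t + t).
Proof.
apply: le_trans (sqr_mass_sub_uniform_le A t p down_up_sym sum_down_up1) _.
have -> : #|ksubset T n|%:R * law down_up A (t + t) A
    = \sum_B law down_up B (t + t) B.
  rewrite mulr_natl -sumr_const; apply: eq_bigr => B _.
  exact: law_diag_const.
rewrite sum_law_diag big_ord_recl /johnson_dim bin0 !subr0 divff ?lt0r_neq0 //.
by rewrite expr1n mulr1 addrAC subrr add0r.
Qed.

End DownUpWalk.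

(** * Occupation counts *)

Section Occupation.
Variables (R : realType) (Q kappa n : nat).

Local Notation site := ('I_Q * 'I_kappa)%type.
Local Notation config := (ksubset site n).

Definition occ (A : {set site}) (v : 'I_Q) : nat :=
  #|[set x in A | x.1 == v]|.

Lemma card_site_fiber (v : 'I_Q) : #|[set x : site | x.1 == v]| = kappa.
Proof.
have inj : injective (pair v : 'I_kappa -> site) by move=> i j [].
rewrite -[RHS](card_ord kappa) -[RHS](card_imset _ inj).
apply: eq_card => -[u j]; rewrite !inE /=; apply/eqP/imsetP => [->|[i _ [-> _]] //].
by exists j.
Qed.

Lemma occ_setC A v : occ (~: A) v = (kappa - occ A v)%N.
Proof.
suff kE : (occ A v + occ (~: A) v)%N = kappa by rewrite -[X in (X - _)%N]kE addKn.
rewrite -[RHS](card_site_fiber v) -(cardsID A [set x : site | x.1 == v]) /occ.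
by congr (_ + _)%N; apply: eq_card => x; rewrite !inE 1?andbC.
Qed.

Lemma occ_le A v : (occ A v <= kappa)%N.
Proof.
rewrite -[leqRHS](card_site_fiber v) subset_leq_card //.
by apply/fintype.subsetP => x; rewrite !inE => /andP[].
Qed.

Lemma sum_occ (V : nmodType) (A : {set site}) (h : 'I_Q -> V) :
  \sum_(x in A) h x.1 = \sum_v h v *+ occ A v.
Proof.
rewrite (partition_big fst xpredT) //=; apply: eq_bigr => v _.
rewrite (eq_bigr (fun=> h v)); last by move=> x /andP[_ /eqP ->].
by rewrite sumr_const; congr (_ *+ _); apply: eq_card => x; rewrite !inE.
Qed.

Lemma sum_occ_card (A : {set site}) : (\sum_v occ A v)%N = #|A|.
Proof.
rewrite -sum1_card (partition_big fst xpredT) //=; apply: eq_bigr => v _.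
by rewrite /occ -sum1_card; apply: eq_bigl => x; rewrite !inE.
Qed.

Lemma occU1 c (A : {set site}) v : c \notin A ->
  occ (c |: A) v = (occ A v + (v == c.1))%N.
Proof.
move=> cA; rewrite /occ; have [->|vc] := eqVneq v c.1.
  rewrite (_ : [set x in c |: A | x.1 == c.1] = c |: [set x in A | x.1 == c.1]).
    by rewrite cardsU1 !inE (negbTE cA) addnC.
  by apply/setP => x; rewrite !inE andb_orl; case: eqP => // ->; rewrite eqxx.
rewrite addn0; apply: eq_card => x; rewrite !inE.
by case: eqP => // ->; rewrite (eq_sym c.1) (negbTE vc) !andbF.
Qed.

Lemma occD1 b (A : {set site}) v : b \in A ->
  (occ (A :\ b) v + (v == b.1))%N = occ A v.
Proof. by move=> bA; rewrite -occU1 ?inE ?eqxx // finset.setD1K. Qed.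

Lemma profile_of_subproof (A : config) :
  (\sum_(v < Q) ([ffun v => inord (occ (val A) v)] : {ffun 'I_Q -> 'I_kappa.+1}) v == n)%N.
Proof.
under eq_bigr => v _ do rewrite ffunE inordK ?ltnS ?occ_le //.
by rewrite sum_occ_card (valP A).
Qed.

Definition profile_of (A : config) : profile Q kappa n :=
  exist _ [ffun v => inord (occ (val A) v)] (profile_of_subproof A).

Lemma load_profile_of A v : load (profile_of A) v = occ (val A) v.
Proof. by rewrite /load /= ffunE inordK // ltnS occ_le. Qed.

Lemma eq_profile (xi eta : profile Q kappa n) :
  (xi == eta) = [forall v, load xi v == load eta v].
Proof.
apply/eqP/forallP => [-> //|H]; apply: val_inj; apply/ffunP => v.
by apply: val_inj; apply/eqP/H.
Qed.

Lemma moved_same (xi eta : profile Q kappa n) v : moved xi v v eta = (eta == xi).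
Proof. by rewrite eq_profile; apply: eq_forallb => u; rewrite eqn_add2r. Qed.

Lemma moved_occ (A : config) b c eta : b \in val A -> c \notin val A :\ b ->
  [forall v, occ (c |: (val A :\ b)) v == load eta v]
  = moved (profile_of A) b.1 c.1 eta.
Proof.
move=> bA cA; apply: eq_forallb => v.
rewrite load_profile_of -(occD1 v bA) occU1 //.
by rewrite addnAC eqn_add2r eq_sym.
Qed.

(* The number of ways to pick [b] in [A] of class [u] and then [c] outside
   [A - b] of class [w] is [occ A u * (kappa - occ A w + (w == u))]. *)
Lemma sum_swaps (A : {set site}) (h : 'I_Q -> 'I_Q -> R) :
  \sum_(b in A) \sum_(c | c \notin A :\ b) h b.1 c.1
  = \sum_u (occ A u)%:R * \sum_w (kappa%:R - (occ A w)%:R + (w == u)%:R) * h u w.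
Proof.
under [RHS]eq_bigr => u _ do rewrite mulr_natl.
rewrite -(sum_occ A (fun u => \sum_w (kappa%:R - (occ A w)%:R + (w == u)%:R) * h u w)).
apply: eq_bigr => b bA.
under eq_bigl => c do rewrite -in_setC.
rewrite (sum_occ _ (h b.1)); apply: eq_bigr => w _.
rewrite -[LHS]mulr_natl; congr (_ * _).
rewrite occ_setC natrB ?occ_le // -(occD1 w bA) natrD; ring.
Qed.

Hypotheses (n_gt0 : (0 < n)%N) (n_le : (n <= kappa * Q)%N).

Lemma card_site : #|{: site}| = (kappa * Q)%N.
Proof. by rewrite card_prod !card_ord mulnC. Qed.

Let n_leT : (n <= #|{: site}|)%N. Proof. by rewrite card_site. Qed.

(** A swap acts on the counts only through the classes of [b] and [c]. Distinct classes give the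
    moves, equal ones [stay_prob], whose extra 1 is the copy just released. *)
Lemma down_up_lumped A eta :
  \sum_(B | profile_of B == eta) down_up R A B
  = profile_trans R (profile_of A) eta.
Proof.
pose g (B : {set site}) : R := [forall v, occ B v == load eta v]%:R.
transitivity (\sum_B down_up R A B * g (val B)).
  rewrite big_mkcond /=; apply: eq_bigr => B _; rewrite eq_profile /g.
  under eq_forallb do rewrite load_profile_of.
  by case: forallP => _; rewrite ?mulr1 ?mulr0.
rewrite sum_down_up //.
pose h u w : R := (moved (profile_of A) u w eta)%:R.
rewrite (eq_bigr (fun b => \sum_(c | c \notin val A :\ b) h b.1 c.1)); last first.
  by move=> b bA; apply: eq_bigr => c cA; rewrite /g moved_occ.
rewrite sum_swaps /profile_trans.
have -> : (if eta == profile_of A then stay_prob R (profile_of A) else 0)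
    = \sum_(v < Q) (load (profile_of A) v)%:R / n%:R *
        ((1 + kappa%:R - (load (profile_of A) v)%:R) / free_copies R Q kappa n)
        * (eta == profile_of A)%:R.
  by rewrite -mulr_suml; case: eqP; rewrite ?mulr1 ?mulr0.
rewrite -big_split mulr_suml; apply: eq_bigr => u _ /=.
rewrite (bigD1 u) //= eqxx {1}/h moved_same load_profile_of.
rewrite [in RHS]big_mkcondr /= addrC mulrDr mulrDl; congr (_ + _); last first.
  by rewrite /free_copies card_site invfM; ring.
rewrite mulr_sumr mulr_suml; apply: eq_big => [w|w wu]; first by rewrite eq_sym.
rewrite /h /move_prob !load_profile_of (negbTE wu) /free_copies card_site.
by case: moved; rewrite ?mulr0 ?mul0r // mulr1 addr0 invfM; ring.
Qed.

(** * The stationary law as an image of the uniform law *)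

Lemma prod_natr_forall (I : finType) (p : pred I) :
  \prod_i (p i)%:R = [forall i, p i]%:R :> R.
Proof.
case: forallP => [H|/forallP]; first by rewrite big1 // => i _; rewrite H.
rewrite negb_forall => /existsP[i /negbTE pi].
by rewrite (bigD1 i) //= pi mul0r.
Qed.

Lemma card_profile_of eta :
  \sum_(A | profile_of A == eta) 1 = \prod_v 'C(kappa, load eta v)%:R :> R.
Proof.
pose F (A : {set site}) : R := [forall v, occ A v == load eta v]%:R.
transitivity (\sum_(A : config) F (val A)).
  rewrite big_mkcond /=; apply: eq_bigr => A _; rewrite eq_profile /F.
  under eq_forallb do rewrite load_profile_of.
  by case: forallP.
rewrite sum_ksubset.
transitivity (\sum_A F A).
  rewrite big_mkcond /=; apply: eq_bigr => A _; rewrite /F.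
  case: forallP; last by case: ifP.
  move=> H; rewrite (_ : #|A| == n) // -sum_occ_card -(eqP (valP eta)).
  by apply/eqP/eq_bigr => v _; apply/eqP/H.
(* [gr] glues one set of copies per resource into a configuration, so that the indicator of
   prescribed counts factors over the resources. *)
pose gr (f : {ffun 'I_Q -> {set 'I_kappa}}) : {set site} := [set x | x.2 \in f x.1].
have gr_bij : bijective gr.
  exists (fun A : {set site} => [ffun v => [set j | (v, j) \in A]]).
    by move=> f; apply/ffunP => v; rewrite ffunE; apply/setP => j; rewrite !inE.
  by move=> A; apply/setP => -[v j]; rewrite !inE ffunE inE.
rewrite (reindex gr) /=; last exact: onW_bij.
have draws v : 'C(kappa, load eta v)%:R
    = \sum_(B : {set 'I_kappa}) (#|B| == load eta v)%:R :> R.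
  have := card_draws 'I_kappa (load eta v); rewrite [X in 'C(X, _)]card_ord => <-.
  rewrite -sum1_card natr_sum big_mkcond /=; apply: eq_bigr => B _.
  by rewrite inE; case: eqP.
under [RHS]eq_bigr do rewrite draws.
rewrite bigA_distr_bigA /=; apply: eq_bigr => f _.
rewrite /F -prod_natr_forall; apply: eq_bigr => v _.
have -> : occ (gr f) v = #|f v|.
  have inj : injective (pair v : 'I_kappa -> site) by move=> i j [].
  rewrite /occ -[RHS](card_imset _ inj); apply: eq_card => -[u j]; rewrite !inE /=.
  apply/andP/imsetP => [[jf /eqP <-]|[i iv [-> ->]]] //; by exists j.
by [].
Qed.

Lemma profile_of_surj eta : exists A, profile_of A = eta.
Proof.
have : 0 < \sum_(A | profile_of A == eta) 1 :> R.
  rewrite card_profile_of prodr_gt0 // => v _.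
  by rewrite ltr0n bin_gt0 -ltnS; exact: ltn_ord.
case: (pickP (fun A => profile_of A == eta)) => [A /eqP AE _|no]; first by exists A.
by rewrite big_pred0 // ltxx.
Qed.

(** Since [1 / (k! (kappa - k)!)] is the binomial coefficient divided by [kappa!], the weight is the
    fibre size times a constant [c], which the normalisation cancels. *)
Lemma profile_piE eta :
  profile_pi R eta = \sum_(A | profile_of A == eta) #|{: config}|%:R^-1.
Proof.
pose c : R := \prod_(v < Q) (kappa`!)%:R^-1.
have wE xi : profile_weight R xi = c * \sum_(A | profile_of A == xi) 1.
  rewrite card_profile_of /c -big_split; apply: eq_bigr => v _ /=.
  rewrite -(bin_fact (m := load xi v) (n := kappa)); last by rewrite -ltnS; exact: ltn_ord.
  have bp : 'C(kappa, load xi v)%:R != 0 :> R.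
    by rewrite pnatr_eq0 -lt0n bin_gt0 -ltnS; exact: ltn_ord.
  by rewrite [in RHS]natrM invfM mulrAC mulVf ?mul1r.
have c0 : c != 0.
  by apply/prodf_neq0 => v _; rewrite invr_eq0 pnatr_eq0 -lt0n fact_gt0.
have cE : #|{: config}|%:R = \sum_xi \sum_(A | profile_of A == xi) 1 :> R.
  by rewrite -sum1_card natr_sum (partition_big profile_of xpredT).
have -> : profile_pi R eta
    = (c * \sum_(A | profile_of A == eta) 1) / (c * #|{: config}|%:R).
  rewrite /profile_pi wE; congr (_ / _); rewrite cE mulr_sumr.
  by apply: eq_bigr => xi _; exact: wE.
by rewrite -mulf_div divff // mul1r mulr_suml; apply: eq_bigr => A _; rewrite mul1r.
Qed.

End Occupation.

(** * The second moment method *)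

Section SecondMoment.
Variables (R : realType) (X : finType) (P : X -> X -> R) (f : X -> R) (lam : R).
Hypotheses (P_ge0 : forall z w, 0 <= P z w) (P1 : forall z, \sum_w P z w = 1).
Hypothesis Psym : forall z w, P z w = P w z.
Hypotheses (lam_gt0 : 0 < lam) (lam_le1 : lam <= 1).
Hypothesis Pf : forall z, \sum_w P z w * f w = (1 - lam) * f z.
(** Given [Pf], this says that the squared increment of [f] in one step has mean at most 1. *)
Hypothesis Pf2 : forall z,
  \sum_w P z w * f w ^+ 2 <= (1 - 2 * lam) * f z ^+ 2 + 1.

Lemma sum_law0 x (g : X -> R) : \sum_y law P x 0 y * g y = g x.
Proof.
rewrite (bigD1 x) //= /law /= eqxx mul1r big1 ?addr0 // => y /negbTE ->.
by rewrite mul0r.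
Qed.

Lemma law_eigen x t : \sum_y law P x t y * f y = (1 - lam) ^+ t * f x.
Proof.
elim: t => [|t IHt]; first by rewrite sum_law0 mul1r.
rewrite law_sum exprS -mulrA -IHt mulr_sumr; apply: eq_bigr => z _.
by rewrite Pf mulrCA.
Qed.

(** The variance stays below [1 / lam]: a step multiplies the second moment by at most
    [(1 - lam) ^+ 2] and adds at most 1, and [(1 - lam) ^+ 2 / lam + 1 <= 1 / lam]. *)
Lemma law_eigen_sqr_le x t :
  \sum_y law P x t y * f y ^+ 2 <= ((1 - lam) ^+ t * f x) ^+ 2 + lam^-1.
Proof.
elim: t => [|t IHt]; first by rewrite sum_law0 mul1r lerDl invr_ge0 ltW.
rewrite law_sum; set S := \sum_y _ in IHt.
have : \sum_z law P x t z * \sum_y P z y * f y ^+ 2 <= (1 - lam) ^+ 2 * S + 1.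
  rewrite -[X in _ + X](law_mass1 x t P1) mulr_sumr -big_split; apply: ler_sum => z _ /=.
  have lz := law_ge0 x t z P_ge0; rewrite mulrCA -[X in _ + X]mulr1 -mulrDr.
  apply: ler_wpM2l => //; apply: le_trans (Pf2 z) _; rewrite lerD2r.
  by apply: ler_wpM2r; rewrite ?sqr_ge0 //; have := sqr_ge0 lam; lra.
move/le_trans; apply; set M := (1 - lam) ^+ t * f x in IHt.
rewrite (exprS _ t) -mulrA -/M exprMn.
apply: le_trans (lerD (ler_wpM2l (sqr_ge0 (1 - lam)) IHt) (lexx 1)) _.
rewrite mulrDr -addrA lerD2l.
have : (1 - lam) ^+ 2 * lam^-1 <= (1 - lam) * lam^-1.
  apply: ler_wpM2r; first by rewrite invr_ge0 ltW.
  have : 0 <= lam * (1 - lam) by rewrite mulr_ge0 ?subr_ge0 // ltW.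
  by rewrite expr2; lra.
by rewrite mulrBl mul1r divff ?gt_eqF //; lra.
Qed.

(** Sum [Pf2] over all states: by symmetry the uniform law is stationary, so the second moments on
    both sides cancel up to the drift. *)
Lemma mean_eigen_sqr_le : 2 * lam * \sum_z f z ^+ 2 <= #|X|%:R.
Proof.
have : \sum_z \sum_w P z w * f w ^+ 2
       <= \sum_z ((1 - 2 * lam) * f z ^+ 2 + 1) by apply: ler_sum.
rewrite exchange_big big_split /= -mulr_sumr sumr_const.
under eq_bigr => w _.
  rewrite -mulr_suml; under eq_bigr do rewrite Psym.
  rewrite P1 mul1r.
  over.
lra.
Qed.

(** Chebyshev at the threshold [m / 2]: the chain falls below it with probability at most
    [4 / (lam m^2)], and the uniform law, of mean square at most [1 / (2 lam)], exceeds it with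
    probability at most [2 / (lam m^2)]. *)
Lemma second_moment_separation x t (m := (1 - lam) ^+ t * f x) : 0 < m ->
  1 - 6 / (lam * m ^+ 2)
  <= \sum_(y | m / 2 <= f y) law P x t y
     - #|[pred y | m / 2 <= f y]|%:R / #|X|%:R.
Proof.
move=> m0; have X0 : 0 < #|X|%:R :> R by rewrite ltr0n; apply/card_gt0P; exists x.
have lm0 : 0 < lam * m ^+ 2 by rewrite mulr_gt0 // exprn_gt0.
have mm0 : 0 < m ^+ 2 by rewrite exprn_gt0.
have below : \sum_(y | ~~ (m / 2 <= f y)) law P x t y <= 4 / (lam * m ^+ 2).
  have : \sum_(y | ~~ (m / 2 <= f y)) law P x t y
      <= \sum_y law P x t y * (4 / m ^+ 2 * (f y - m) ^+ 2).
    rewrite big_mkcond; apply: ler_sum => y _; have ly := law_ge0 x t y P_ge0.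
    case: ifPn => [|_]; last by rewrite mulr_ge0 // mulr_ge0 ?sqr_ge0 // divr_ge0 // ltW.
    rewrite -ltNge => fy; rewrite ler_peMr // mulrAC ler_pdivlMr // mul1r.
    have -> : 4 * (f y - m) ^+ 2 = (2 * (m - f y)) ^+ 2 by ring.
    by rewrite ler_pXn2r // ?nnegrE; lra.
  move/le_trans; apply.
  have -> : \sum_y law P x t y * (4 / m ^+ 2 * (f y - m) ^+ 2)
      = 4 / m ^+ 2 * (\sum_y law P x t y * f y ^+ 2
          - 2 * m * (\sum_y law P x t y * f y) + m ^+ 2 * \sum_y law P x t y).
    rewrite !mulr_sumr -sumrB -big_split mulr_sumr; apply: eq_bigr => y _ /=; ring.
  rewrite law_eigen law_mass1 // -/m.
  rewrite (_ : 4 / (lam * m ^+ 2) = 4 / m ^+ 2 * lam^-1); last by rewrite invfM; ring.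
  apply: ler_wpM2l; first by rewrite divr_ge0 // ltW.
  by have := law_eigen_sqr_le x t; rewrite -/m; lra.
have unif : #|[pred y | m / 2 <= f y]|%:R / #|X|%:R <= 2 / (lam * m ^+ 2).
  rewrite ler_pdivrMr // [leRHS]mulrAC ler_pdivlMr //.
  have : #|[pred y | m / 2 <= f y]|%:R * m ^+ 2 <= 4 * \sum_z f z ^+ 2.
    rewrite -sum1_card natr_sum big_mkcond mulr_suml mulr_sumr.
    apply: ler_sum => y _; rewrite inE.
    case: ifPn => [fy|_]; last by rewrite mul0r mulr_ge0 // sqr_ge0.
    rewrite mul1r (_ : 4 * _ = (2 * f y) ^+ 2); last by ring.
    by rewrite ler_pXn2r // ?nnegrE; lra.
  move=> /(ler_wpM2l (ltW lam_gt0)); have := mean_eigen_sqr_le.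
  set s := \sum_z _; set c := #|_|%:R; set d := #|_|%:R; lra.
have := law_mass1 x t P1; rewrite (bigID (fun y => m / 2 <= f y)) /=.
have -> : 6 / (lam * m ^+ 2) = 4 / (lam * m ^+ 2) + 2 / (lam * m ^+ 2).
  by rewrite -mulrDl; congr (_ / _); ring.
lra.
Qed.

End SecondMoment.

(** * The excess load of one resource and its extreme configurations *)

Lemma subset_of_card (T : finType) (A C : {set T}) k :
  A \subset C -> (#|A| <= k)%N -> (k <= #|C|)%N ->
  exists B : {set T}, [/\ A \subset B, B \subset C & #|B| = k].
Proof.
move=> AC Ak; rewrite -(subnKC Ak); elim: (k - #|A|)%N => [|d IHd] dC.
  by exists A; rewrite addn0.
have [|B [AB BC cB]] := IHd; first by apply: leq_trans dC; rewrite leq_add2l.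
have : ~~ (C \subset B) by apply: contraL dC => /subset_leq_card; rewrite cB addnS -ltnNge ltnS.
case/subsetPn => x xC xB; exists (x |: B); split.
- exact: fintype.subset_trans AB (subsetUr _ _).
- by rewrite finset.subUset sub1set xC.
- by rewrite cardsU1 xB cB addnS.
Qed.

Section OccupationMoments.
Variables (R : realType) (Q kappa n : nat) (v : 'I_Q).
Hypotheses (n_gt0 : (0 < n)%N) (n_le : (n <= kappa * Q)%N).

Local Notation site := ('I_Q * 'I_kappa)%type.
Local Notation config := (ksubset site n).
Local Notation N := ((kappa * Q)%:R : R).
Local Notation free := (1 + (kappa * Q)%:R - n%:R : R).

Definition excess (A : {set site}) : R := (occ A v)%:R - n%:R / Q%:R.

(** [1 - gap] is the factor for [i = 1] in the trace formula, since
    [(n - 1) (free - 1) = n free - N]. *)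
Definition gap : R := N / (n%:R * free).

Let n_leT : (n <= #|{: site}|)%N. Proof. by rewrite card_site. Qed.

Let free_gt0 : 0 < free.
Proof. by rewrite -addrA ltr_wpDr // subr_ge0 ler_nat. Qed.

Let nfree_gt0 : 0 < n%:R * free.
Proof. by rewrite mulr_gt0 ?ltr0n. Qed.

Lemma gap_gt0 : 0 < gap.
Proof. by rewrite divr_gt0 // ltr0n; lia. Qed.

Lemma gap_le1 : gap <= 1.
Proof.
rewrite ler_pdivrMr // mul1r.
have n1 : 1 <= n%:R :> R by rewrite ler1n.
have nN : n%:R <= N by rewrite ler_nat.
nra.
Qed.

Lemma sum_down_up_shift (A : config) (g : R -> R) :
  \sum_B down_up R A B * g (excess (val B) - excess (val A))
  = (\sum_u (occ (val A) u)%:R *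
       \sum_w (kappa%:R - (occ (val A) w)%:R + (w == u)%:R)
              * g ((v == w)%:R - (v == u)%:R)) / (n%:R * free).
Proof.
rewrite (sum_down_up A (fun B => g (excess B - excess (val A)))).
rewrite card_site; congr (_ / _).
rewrite -(sum_swaps (val A) (fun u w => g ((v == w)%:R - (v == u)%:R))).
apply: eq_bigr => b bA; apply: eq_bigr => c cA; congr g.
rewrite /excess occU1 // -(occD1 v bA) !natrD; ring.
Qed.

(** The numerator is [n (kappa - a v) + a v (n - N)], which equals [- N (a v - n / Q)] because
    [N = kappa Q]. *)
Lemma excess_drift (A : config) :
  \sum_B down_up R A B * (excess (val B) - excess (val A))
  = - gap * excess (val A).
Proof.
rewrite (sum_down_up_shift A id) /gap mulNr mulrAC -mulNr; congr (_ / _).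
have Q0 : Q%:R != 0 :> R by rewrite pnatr_eq0; case: (v) => i; lia.
set a := occ (val A).
have sa : \sum_u (a u)%:R = n%:R :> R.
  by rewrite -natr_sum sum_occ_card (eqP (valP A)).
have sk : \sum_w (kappa%:R - (a w)%:R) = N - n%:R :> R.
  by rewrite sumrB sa sumr_const card_ord natrM mulr_natr.
have inner u : \sum_w (kappa%:R - (a w)%:R + (w == u)%:R) * ((v == w)%:R - (v == u)%:R)
    = kappa%:R - (a v)%:R + (v == u)%:R - (v == u)%:R * (N - n%:R + 1).
  under eq_bigr do rewrite mulrBr.
  rewrite sumrB -mulr_suml big_split /= sk; congr (_ - _).
    rewrite (bigD1 v) //= eqxx mulr1 big1 ?addr0 // => w wv.
    by rewrite (eq_sym v) (negbTE wv) mulr0.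
  rewrite (bigD1 u) //= eqxx big1 ?addr0 1?mulrC // => w wu.
  by rewrite (negbTE wu).
under eq_bigr do rewrite inner.
have -> : \sum_(u < Q) (a u)%:R * (kappa%:R - (a v)%:R + (v == u)%:R
    - (v == u)%:R * (N - n%:R + 1))
  = \sum_(u < Q) (a u)%:R * (kappa%:R - (a v)%:R)
    + \sum_(u < Q) (a u)%:R * (v == u)%:R * (n%:R - N).
  by rewrite -big_split; apply: eq_bigr => u _ /=; ring.
rewrite -!mulr_suml sa (bigD1 v) //= eqxx big1 => [|u uv]; last first.
  by rewrite (eq_sym v) (negbTE uv) mulr0.
by rewrite /excess -/a natrM /= mulr1n; field.
Qed.

(** A swap changes the load of [v] by at most one, so the sum is compared termwise with the one for
    the constant 1, which is the total mass. *)
Lemma excess_sqr_drift (A : config) :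
  \sum_B down_up R A B * (excess (val B) - excess (val A)) ^+ 2 <= 1.
Proof.
rewrite (sum_down_up_shift A (fun d => d ^+ 2)).
have := sum_down_up_shift A (fun=> 1); under eq_bigr do rewrite mulr1.
rewrite sum_down_up1 // => E1; rewrite [leRHS]E1 ler_pM2r ?invr_gt0 //.
apply: ler_sum => u _; apply: ler_wpM2l => //; apply: ler_sum => w _.
apply: ler_wpM2l; last by case: (v == w); case: (v == u); rewrite ?subrr ?subr0 ?sub0r ?sqrrN ?expr1n ?expr0n.
by rewrite addr_ge0 // subr_ge0 ler_nat occ_le.
Qed.

Lemma down_up_excess (A : config) :
  \sum_B down_up R A B * excess (val B) = (1 - gap) * excess (val A).
Proof.
have := excess_drift A; under eq_bigr do rewrite mulrBr.
rewrite sumrB -mulr_suml sum_down_up1 // mul1r; lra.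
Qed.

Lemma down_up_excess_sqr (A : config) :
  \sum_B down_up R A B * excess (val B) ^+ 2
  <= (1 - 2 * gap) * excess (val A) ^+ 2 + 1.
Proof.
have := excess_sqr_drift A; set e := excess (val A).
have -> : \sum_B down_up R A B * (excess (val B) - e) ^+ 2
    = \sum_B down_up R A B * excess (val B) ^+ 2
      - 2 * e * (\sum_B down_up R A B * excess (val B))
      + e ^+ 2 * \sum_B down_up R A B.
  by rewrite !mulr_sumr -sumrB -big_split; apply: eq_bigr => B _ /=; ring.
rewrite down_up_excess sum_down_up1 // -/e => H.
by rewrite -[leLHS](addrK (e ^+ 2)); nra.
Qed.

Lemma tv_dist_profile_ge (A : config) t (m := (1 - gap) ^+ t * excess (val A)) :
  0 < m ->
  1 - 6 / (gap * m ^+ 2)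
  <= tv_dist (@profile_trans R Q kappa n) (@profile_pi R Q kappa n) t.
Proof.
move=> m0; pose E := [set xi : profile Q kappa n | m / 2 <= (load xi v)%:R - n%:R / Q%:R].
apply: le_trans (le_tv_dist _ _ t (profile_of A) E).
apply: le_trans (ler_norm _).
rewrite (mass_lumped (f := @profile_of Q kappa n) (mu := law (@down_up R _ n) A t)); last first.
  by move=> y; apply: law_lumped => x z; apply: down_up_lumped.
rewrite (mass_lumped (f := @profile_of Q kappa n) (mu := fun=> #|{: config}|%:R^-1)); last first.
  by move=> y; apply: profile_piE.
have EE B : (profile_of B \in E) = (m / 2 <= excess (val B)).
  by rewrite inE load_profile_of.
rewrite !(eq_bigl _ _ EE) sumr_const -[_ *+ #|_|]mulr_natl.
apply: (second_moment_separation (f := fun B : config => excess (val B))) => //.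
- by move=> z w; apply: down_up_ge0.
- by move=> z; apply: sum_down_up1.
- by move=> z w; apply: down_up_sym.
- exact: gap_gt0.
- exact: gap_le1.
- exact: down_up_excess.
- exact: down_up_excess_sqr.
Qed.

(** Occupy copies of [v] only, or all copies of [v] if [n] exceeds [kappa]. *)
Lemma exists_extreme_config : exists A : config, occ (val A) v = minn n kappa.
Proof.
pose V := [set x : site | x.1 == v].
have cV : #|V| = kappa by apply: card_site_fiber.
have occI (A : {set site}) : occ A v = #|A :&: V|.
  by apply: eq_card => x; rewrite !inE.
have [nk|kn] := leqP n kappa.
  have [||B [_ BV cB]] := @subset_of_card _ set0 V n (sub0set _).
  - by rewrite cards0.
  - by rewrite cV.
  have pB : #|B| == n by apply/eqP.
  by exists (Sub B pB); rewrite occI /= (setIidPl BV).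
have [||B [VB _ cB]] := @subset_of_card _ V setT n (finset.subsetT _).
- by rewrite cV ltnW.
- by rewrite cardsT.
have pB : #|B| == n by apply/eqP.
by exists (Sub B pB); rewrite occI /= (setIidPr VB) cV.
Qed.

End OccupationMoments.

(** * The L2 bound on the load profile chain *)

Lemma bin_le_exp n m : ('C(n, m) <= n ^ m)%N.
Proof.
elim: n m => [|n IHn] [|m] //; rewrite ?bin0 //.
rewrite binS; apply: leq_trans (leq_add (IHn m.+1) (IHn m)) _.
by rewrite expnS -mulSnr expnS leq_mul //; case: m => // m; rewrite leq_exp2r.
Qed.

Lemma sum_geometric_le (R : realType) (x : R) n : 0 <= x -> x <= 2^-1 ->
  \sum_(i < n) x ^+ i.+1 <= 2 * x.
Proof.
(* Adding the tail [2 * x ^+ n.+1] makes the bound inductive. *)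
move=> x0 x1; suff : \sum_(i < n) x ^+ i.+1 + 2 * x ^+ n.+1 <= 2 * x.
  by have := exprn_ge0 n.+1 x0; lra.
elim: n => [|n IHn]; first by rewrite big_ord0 add0r.
apply: le_trans IHn; rewrite big_ord_recr /= -addrA lerD2l.
by rewrite [x ^+ n.+2]exprS; have := exprn_ge0 n.+1 x0; nra.
Qed.

Section MixingBounds.
Variables (R : realType) (Q kappa n : nat).
Hypotheses (n_gt0 : (0 < n)%N) (n_le : (n.*2 <= kappa * Q)%N).

Local Notation site := ('I_Q * 'I_kappa)%type.
Local Notation config := (ksubset site n).
Local Notation N := ((kappa * Q)%:R : R).
Local Notation free := (1 + (kappa * Q)%:R - n%:R : R).
Local Notation tv :=
  (tv_dist (@profile_trans R Q kappa n) (@profile_pi R Q kappa n)).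

Let n_le' : (n <= kappa * Q)%N. Proof. by lia. Qed.

Let n_free : n%:R + 1 <= free.
Proof.
have : (n.*2)%:R <= N by rewrite ler_nat.
by rewrite -mul2n natrM; lra.
Qed.

Let n_pos : 0 < n%:R :> R. Proof. by rewrite ltr0n. Qed.

Lemma johnson_eigenvalue_bounds i : (i <= n)%N ->
  0 <= (n%:R - i%:R) * (free - i%:R) / (n%:R * free)
    <= expR (- (i%:R * (n%:R^-1 + free^-1))).
Proof.
move=> le_in; have i_n : i%:R <= n%:R :> R by rewrite ler_nat.
have free0 : 0 < free by have := n_free; have := n_pos; lra.
have iE (a : R) : 1 - i%:R / a <= expR (- (i%:R / a)) by exact: expR_ge1Dx.
have -> : (n%:R - i%:R) * (free - i%:R) / (n%:R * free)
    = (1 - i%:R / n%:R) * (1 - i%:R / free).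
  by field; rewrite -natrM (gt_eqF free0) (gt_eqF n_pos).
have in1 : 0 <= 1 - i%:R / n%:R :> R by rewrite subr_ge0 ler_pdivrMr ?mul1r.
have if1 : 0 <= 1 - i%:R / free by rewrite subr_ge0 ler_pdivrMr ?mul1r //; have := n_free; lra.
rewrite mulr_ge0 //= [X in expR (- X)]mulrDr opprD expRD ler_pM //; exact: iE.
Qed.

(** With [x] the left side of the last hypothesis, the [i]-th spectral term is at most [x ^+ i]: the
    dimension is at most [N ^+ i] and the eigenvalue power is bounded exponentially. As [x <= 1/2],
    the series is at most [2 x <= e ^+ 2]. *)
Lemma tv_dist_profile_le t (e : R) : 0 <= e -> e <= 1 ->
  N * expR (- (2 * t%:R * (n%:R^-1 + free^-1))) <= e ^+ 2 / 2 -> tv t <= e.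
Proof.
move=> e0 e1; set x := N * _ => x_le.
have x0 : 0 <= x by rewrite mulr_ge0 // expR_ge0.
have e21 : e ^+ 2 <= 1 by rewrite exprn_ile1.
apply: tv_dist_le => // xi A; have [B <-] := profile_of_surj R xi.
rewrite (mass_lumped (f := @profile_of Q kappa n) (mu := law (@down_up R _ n) B t)); last first.
  by move=> y; apply: law_lumped => z w; apply: down_up_lumped.
rewrite (mass_lumped (f := @profile_of Q kappa n) (mu := fun=> #|{: config}|%:R^-1)); last first.
  by move=> y; apply: profile_piE.
rewrite sumr_const -[_ *+ #|_|]mulr_natl -(ler_pXn2r (n := 2)) ?nnegrE //.
rewrite real_normK ?num_real //.
have nT : (n <= #|{: site}|)%N by rewrite card_site.
apply: le_trans (sqr_mass_down_up_le _ n_gt0 nT t B _) _; rewrite card_site.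
have : \sum_(i < n) x ^+ i.+1 <= 2 * x by apply: sum_geometric_le => //; lra.
move=> geom; apply: le_trans (_ : \sum_(i < n) x ^+ i.+1 <= _); last by lra.
apply: ler_sum => i _; case/andP: (johnson_eigenvalue_bounds (ltn_ord i)).
set mu := (n%:R - i.+1%:R) * _ / _ => mu0 mu1; rewrite -/mu /x [in leRHS]exprMn.
apply: le_trans (_ : N ^+ i.+1 * mu ^+ (t + t) <= _).
  apply: ler_wpM2r; first by rewrite exprn_ge0.
  rewrite /johnson_dim card_site; apply: le_trans (_ : 'C(kappa * Q, i.+1)%:R <= _).
    by rewrite gerBl.
  by rewrite -natrX ler_nat bin_le_exp.
apply: ler_wpM2l; first by rewrite exprn_ge0.
apply: le_trans (_ : expR (- (i.+1%:R * (n%:R^-1 + free^-1))) ^+ (t + t) <= _).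
  by rewrite lerXn2r ?nnegrE // expR_ge0.
rewrite -!expRM_natl ler_expR natrD; lra.
Qed.

End MixingBounds.

(** * The cutoff window *)

Lemma upper_window (R : realType) (rho N n c t : R) : 0 < rho -> rho <= 2^-1 ->
  1 <= n -> n <= rho * N -> rho * N < n + 1 -> 0 <= c ->
  2^-1 * (1 - rho) * n * ln n + c * n <= t ->
  N * expR (- (2 * t * (n^-1 + (1 + N - n)^-1))) <= 2 / rho * expR (2 - 2 * c).
Proof.
move=> rho0 rho1 n1 nN Nn c0 tn; set D := 1 + N - n; set L := ln n in tn *.
have n0 : 0 < n by lra.
have N0 : 0 < N by have : 0 < rho * N; [lra | rewrite pmulr_rgt0].
have N2 : n * 2 <= N by have : (2^-1 - rho) * N >= 0; [rewrite mulr_ge0; lra | lra].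
have D0 : 0 < D by rewrite /D; lra.
have L0 : 0 <= L by apply: ln_ge0.
have Ln : L < n by apply: ln_sublinear.
(* From [rho * N < n + 1] follows [D - 2 <= (1 - rho) N]; the resulting loss [2 L] is at most [2 D],
   which accounts for the [- 2]. *)
have LX : L - 2 + 2 * c <= 2 * t * (n^-1 + D^-1).
  apply: le_trans (_ : ((1 - rho) * L + 2 * c) * n * (n^-1 + D^-1) <= _); last first.
    apply: ler_wpM2r; first by rewrite addr_ge0 // invr_ge0 ltW.
    lra.
  have -> : ((1 - rho) * L + 2 * c) * n * (n^-1 + D^-1)
      = ((1 - rho) * L + 2 * c) * (N + 1) / D.
    by rewrite /D; field; rewrite -/D (gt_eqF n0) (gt_eqF D0).
  rewrite ler_pdivlMr //.
  have h1 : (D - 2) * L <= (1 - rho) * (N + 1) * L.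
    by apply: ler_wpM2r => //; rewrite /D; nra.
  have h2 : c * D <= c * (N + 1) by apply: ler_wpM2l => //; rewrite /D; lra.
  have h3 : L <= D by rewrite /D; lra.
  lra.
apply: le_trans (_ : N * expR (- (L - 2 + 2 * c)) <= _).
  by apply: ler_wpM2l; rewrite ?ler_expR ?lerN2 // ltW.
rewrite (_ : - (L - 2 + 2 * c) = - L + (2 - 2 * c)); last by ring.
rewrite expRD expRN lnK ?posrE // mulrA; apply: ler_wpM2r; first exact: expR_ge0.
(* [N / n <= 2 / rho], because [rho * N < n + 1 <= 2 n]. *)
by rewrite ler_pdivrMr // mulrAC ler_pdivlMr //; lra.
Qed.

(** Weak separation forces [g m^2 <= 6 / (1 - eps)]. With [g >= 1 / n] and [f0 >= n / q] this makes
    [(1 - g) ^+ (2 t)] at most [exp (K - L)], and [g <= 1 / ((1 - rho) n)] turns that decay into a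
    lower bound on [t]. *)
Lemma lower_window (R : realType) (rho N n q f0 eps : R) (t : nat)
    (g := N / (n * (1 + N - n))) (m := (1 - g) ^+ t * f0) :
  0 < rho -> rho <= 2^-1 -> 4 <= n -> n <= rho * N ->
  2 <= q -> n / q <= f0 -> 0 < eps -> eps < 1 ->
  0 < m /\
  (1 - 6 / (g * m ^+ 2) <= eps ->
   2^-1 * (1 - rho) * n * ln n - (ln (6 * q ^+ 2 / (1 - eps)) + 1) * n <= t%:R).
Proof.
move=> rho0 rho1 n4 nN q2 f0n eps0 eps1; set L := ln n; set K := ln _.
have n0 : 0 < n by lra.
have N0 : 0 < N by have : 0 < rho * N; [lra | rewrite pmulr_rgt0].
have N2 : n * 2 <= N by have : (2^-1 - rho) * N >= 0; [rewrite mulr_ge0; lra | lra].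
have D0 : 0 < 1 + N - n by lra.
have nD0 : 0 < n * (1 + N - n) by rewrite mulr_gt0.
have g0 : 0 < g by rewrite divr_gt0.
have g2 : g <= 2^-1 by rewrite ler_pdivrMr //; nra.
have gn : n^-1 <= g.
  by rewrite -[_^-1]mul1r ler_pdivlMr // mulrAC ler_pdivrMr //; nra.
have q0 : 0 < q by lra.
have f00 : 0 < f0 by apply: lt_le_trans f0n; rewrite divr_gt0.
have g1 : 0 < 1 - g by lra.
have m0 : 0 < m by rewrite mulr_gt0 // exprn_gt0.
split=> // H.
have e0 : 0 < 1 - eps by lra.
have gm0 : 0 < g * m ^+ 2 by rewrite mulr_gt0 // exprn_gt0.
have arg0 : 0 < 6 * q ^+ 2 / (1 - eps) by rewrite divr_gt0 // mulr_gt0 // exprn_gt0.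
have L0 : 0 <= L by apply: ln_ge0; lra.
have Ln : L < n by apply: ln_sublinear.
have K0 : 0 <= K.
  apply: ln_ge0; rewrite ler_pdivlMr // mul1r.
  have : 2 * 2 <= q * q by apply: ler_pM.
  by rewrite expr2; lra.
have t0 : 0 <= t%:R :> R by [].
(* For [L <= K] the claimed lower bound on [t] is negative. *)
have [LK|KL] := leP L K.
  have : (1 - rho) * n * L <= n * K.
    rewrite mulrAC [leRHS]mulrC; apply: ler_wpM2r; first lra.
    by have : rho * L >= 0; [rewrite mulr_ge0 // ltW | lra].
  by have := mulr_ge0 (ltW n0) K0; lra.
have gm : g * m ^+ 2 <= 6 / (1 - eps).
  rewrite ler_pdivlMr // mulrC -ler_pdivlMr //; lra.
have pw : ((1 - g) ^+ t) ^+ 2 <= expR (K - L).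
  rewrite expRD expRN !lnK ?posrE // ler_pdivlMr //; set p := (1 - g) ^+ t in m m0 H gm0 gm *.
  have nf : n <= q ^+ 2 * (g * f0 ^+ 2).
    rewrite -[leLHS](_ : q ^+ 2 * (n^-1 * (n / q) ^+ 2) = n); last first.
      by field; rewrite (gt_eqF n0) (gt_eqF q0).
    apply: ler_wpM2l; first exact: sqr_ge0.
    apply: ler_pM => //; first by rewrite invr_ge0 ltW.
      exact: sqr_ge0.
    by rewrite lerXn2r ?nnegrE ?divr_ge0 // ltW.
  apply: le_trans (ler_wpM2l (sqr_ge0 p) nf) _.
  rewrite [leLHS](_ : _ = q ^+ 2 * (g * m ^+ 2)); last by rewrite /m; ring.
  rewrite [leRHS](_ : _ = q ^+ 2 * (6 / (1 - eps))); last by ring.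
  by apply: ler_wpM2l gm; exact: sqr_ge0.
(* [1 - g >= exp (- g / (1 - g))], from [1 + x <= exp x] at [x = g / (1 - g)]. *)
have eg : expR (- (g / (1 - g))) <= 1 - g.
  rewrite expRN -[leRHS]invrK lef_pV2 ?posrE ?invr_gt0 ?expR_gt0 //.
  rewrite [leLHS](_ : _ = 1 + g / (1 - g)); first exact: expR_ge1Dx.
  by field; rewrite (gt_eqF g1).
have : expR (2 * t%:R * - (g / (1 - g))) <= expR (K - L).
  apply: le_trans pw; rewrite -exprM -natrM mulnC expRM_natl mulnC.
  by rewrite lerXn2r ?nnegrE ?expR_ge0 // ltW.
rewrite ler_expR mulrN lerNl opprB mulrA ler_pdivlMr // => tL.
have gr : g * ((1 - rho) * n) <= 1.
  rewrite mulrAC ler_pdivrMr // mul1r.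
  by rewrite [leLHS](_ : _ = n * ((1 - rho) * N)); [apply: ler_wpM2l; lra | ring].
have r0 : 0 < (1 - rho) * n by rewrite mulr_gt0 //; lra.
have : (L - K) * (1 - g) * ((1 - rho) * n) <= 2 * t%:R.
  apply: le_trans (ler_wpM2r (ltW r0) tL) _.
  by rewrite -mulrA -[leRHS]mulr1; apply: ler_wpM2l.
(* The factor [1 - g] costs at most [L - K], which [L < n] absorbs into the window. *)
have h1 : (L - K) * (g * ((1 - rho) * n)) <= (L - K) * 1.
  by apply: ler_wpM2l => //; lra.
have h2 : K * ((1 - rho) * n) <= K * n.
  by apply: ler_wpM2l => //; nra.
have := mulr_ge0 K0 (ltW n0); lra.
Qed.

Theorem theorem1p2 (R : realType) (Q : nat) (hQ : (2 <= Q)%N)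
    (rho : R) (hrho0 : 0 < rho) (hrho1 : rho <= 2^-1)
    (eps : R) (heps0 : 0 < eps) (heps1 : eps < 1) :
  exists (C : R) (N : nat), forall kappa : nat, (0 < kappa)%N ->
    let n := Num.truncn (rho * kappa%:R * Q%:R) in
    (N <= n)%N ->
    exists tmix : nat,
      is_mixing_time (@profile_trans R Q kappa n) (@profile_pi R Q kappa n)
        eps tmix /\
      `|tmix%:R - 2^-1 * (1 - rho) * n%:R * ln (n%:R)| <= C * n%:R.
Proof.
(* [c] solves [2 / rho * expR (2 - 2 * c) = eps ^+ 2 / 2], the target of the L2 bound; [K] is the
   constant of [lower_window] at [q = Q]. *)
pose c : R := 1 - 2^-1 * ln (rho * eps ^+ 2 / 4).
pose K : R := ln (6 * Q%:R ^+ 2 / (1 - eps)).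
have re0 : 0 < rho * eps ^+ 2 / 4 by rewrite divr_gt0 // mulr_gt0 // exprn_gt0.
have e21 : eps ^+ 2 <= 1 by rewrite exprn_ile1 ?ltW.
have c0 : 0 <= c.
  have : ln (rho * eps ^+ 2 / 4) <= 0 by apply: ln_le0; have := exprn_gt0 2 heps0; nra.
  by rewrite /c; lra.
have Q2 : 2 <= Q%:R :> R by rewrite ler_nat.
have K0 : 0 <= K.
  apply: ln_ge0; rewrite ler_pdivlMr ?subr_gt0 // mul1r.
  have : 2 * 2 <= Q%:R * Q%:R :> R by apply: ler_pM.
  by rewrite expr2; lra.
(* [c n] pays for the upper window, [(K + 1) n] for the lower one, and the rest covers rounding;
   [n >= 4] ensures a gap of at most [1/2]. *)
exists (c + K + 2), 4%N => kappa kappa0 n n4.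
have x0 : 0 <= rho * kappa%:R * Q%:R by rewrite !mulr_ge0 // ltW.
have /andP[nle nlt] : n%:R <= rho * (kappa * Q)%:R < n%:R + 1.
  by rewrite natrM mulrA natr1; exact: truncn_itv.
have n4R : 4 <= n%:R :> R by rewrite ler_nat.
have n_gt0 : (0 < n)%N by apply: leq_trans n4.
have n_le : (n.*2 <= kappa * Q)%N.
  rewrite -(ler_nat R) -mul2n natrM.
  by have : 0 <= (2^-1 - rho) * (kappa * Q)%:R; [rewrite mulr_ge0 // subr_ge0 | lra].
set tv := tv_dist (@profile_trans R Q kappa n) (@profile_pi R Q kappa n).
set a := 2^-1 * (1 - rho) * n%:R * ln n%:R.
have L0 : 0 <= ln n%:R :> R by apply: ln_ge0; lra.
have a0 : 0 <= a by rewrite /a !mulr_ge0 //; lra.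
pose T := (Num.truncn (a + c * n%:R)).+1.
have acn0 : 0 <= a + c * n%:R by rewrite addr_ge0 // mulr_ge0.
have /andP[T1 T2] := truncn_itv acn0; rewrite -/T in T2.
have tvT : tv T <= eps.
  apply: tv_dist_profile_le => //; try exact: ltW.
  have := upper_window hrho0 hrho1 _ nle nlt c0 (ltW T2).
  move/(_ _)/le_trans; apply; first lra.
  rewrite (_ : 2 - 2 * c = ln (rho * eps ^+ 2 / 4)); last by rewrite /c; field.
  rewrite lnK ?posrE // le_eqVlt; apply/orP; left; apply/eqP.
  by field; rewrite (gt_eqF hrho0).
have exT : exists t, tv t <= eps by exists T.
have [tmix tmixP tmix_min] := ex_minnP exT.
exists tmix; split; first by split.
have upper : tmix%:R <= a + c * n%:R + 1.
  apply: le_trans (_ : T%:R <= _); first by rewrite ler_nat tmix_min.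
  by rewrite /T -natr1 lerD2r.
have lower : a - (K + 1) * n%:R <= tmix%:R.
  pose Qi : 'I_Q := Ordinal (ltnW hQ).
  have n_le' : (n <= kappa * Q)%N by apply: leq_trans n_le; rewrite -addnn leq_addr.
  have [A occA] := exists_extreme_config Qi n_le'.
  (* [minn n kappa] is at least [2 n / Q] in both cases: by [2 <= Q], or by [2 n <= kappa Q]. *)
  have fA : n%:R / Q%:R <= excess R n Qi (val A).
    rewrite /excess occA lerBrDr -mulr2n -mulrnAl ler_pdivrMr; last lra.
    rewrite -mulrnA -natrM ler_nat /minn; case: ltnP => _; last by rewrite muln2.
    by rewrite leq_mul2l hQ orbT.
  have [m0 Hm] := lower_window tmix hrho0 hrho1 n4R nle Q2 fA heps0 heps1.
  apply: Hm; apply: le_trans tmixP; exact: tv_dist_profile_ge.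
have cn0 := mulr_ge0 c0 (ler0n R n); have Kn0 := mulr_ge0 K0 (ler0n R n).
by rewrite ler_norml; apply/andP; split; lra.
Qed.
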